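(* Consider the Hubbard model described in the context on a finite connected lattice $\mathcal{M}$ with uniform coordination number $\zeta$, and suppose that the electron number is $N_e=|\mathcal{M}|$. Then, in the limits $U\uparrow\infty$ and $s\uparrow\infty$, the ground states of the model have total spin $S_{\mathrm{tot}}=S_{\max}=N_e/2$, and they are unique up to the trivial $(2S_{\max}+1)$-fold degeneracy.
   Context: Lattice: $\mathcal{M}$ is a finite set of sites. $\mathcal{B}$ is a set of ordered pairs $(x,y)$ of distinct sites of $\mathcal{M}$ (bonds) such that for any $x,y$ at most one of $(x,y),(y,x)$ lies in $\mathcal{B}$. Put $\mathcal{E}=\mathcal{B}\cup\{(y,x):(x,y)\in\mathcal{B}\}$. We assume $\mathcal{M}$ is connected via the bonds in $\mathcal{B}$, and that every $x\in\mathcal{M}$ has exactly $\zeta$ sites $y$ with $(x,y)\in\mathcal{E}$. For each $(x,y)\in\mathcal{B}$ introduce two additional sites $u(x,y)$ and $\bar u(x,y)$; let $\mathcal{O}$ and $\bar{\mathcal{O}}$ be the sets of all $u(x,y)$ and all $\bar u(x,y)$ respectively, and let $\Lambda=\mathcal{M}\cup\mathcal{O}\cup\bar{\mathcal{O}}$. Operators: $c_{z,\sigma}$ ($z\in\Lambda$, $\sigma\in\{\uparrow,\downarrow\}$) are the standard fermion annihilation operators, $n_{z,\sigma}=c^\dagger_{z,\sigma}c_{z,\sigma}$, and $|\Phi_{\mathrm{vac}}\rangle$ is the vacuum. Fix $\mu>0$. For $x\in\mathcal{M}$, $a_{x,\sigma}=(1+2\zeta\mu^2)^{-1/2}\{c_{x,\sigma}+\mu\sum_{y:(x,y)\in\mathcal{B}}(c_{u(x,y),\sigma}-c_{\bar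 u(x,y),\sigma})+\mu\sum_{y:(y,x)\in\mathcal{B}}(c_{u(y,x),\sigma}+c_{\bar u(y,x),\sigma})\}$. For $u=u(x,y)\in\mathcal{O}$, $b_{u,\sigma}=c_{u,\sigma}-\mu(c_{x,\sigma}+c_{y,\sigma})$; for $\bar u=\bar u(x,y)\in\bar{\mathcal{O}}$, $b_{\bar u,\sigma}=c_{\bar u,\sigma}+\mu(c_{x,\sigma}-c_{y,\sigma})$. Hamiltonian, with parameters $s,t,U>0$: $H=t\sum_{(x,y)\in\mathcal{E},\sigma}a^\dagger_{x,\sigma}a_{y,\sigma}+s\sum_{v\in\mathcal{O}\cup\bar{\mathcal{O}},\sigma}b^\dagger_{v,\sigma}b_{v,\sigma}+U\sum_{z\in\Lambda}n_{z,\uparrow}n_{z,\downarrow}$. It acts on the Hilbert space with fixed electron number $N_e\le|\mathcal{M}|$. Spin: $S^+_z=c^\dagger_{z,\uparrow}c_{z,\downarrow}$, $S^-_z=c^\dagger_{z,\downarrow}c_{z,\uparrow}$, $S^{(3)}_z=\tfrac12(n_{z,\uparrow}-n_{z,\downarrow})$, $S^{(1)}_z=(S^+_z+S^-_z)/2$, $S^{(2)}_z=(S^+_z-S^-_z)/(2i)$. The total spin is $\mathbf{S}_{\mathrm{tot}}=\sum_{z\in\Lambda}\mathbf{S}_z$, the eigenvalues of $(\mathbf{S}_{\mathrm{tot}})^2$ are written $S_{\mathrm{tot}}(S_{\mathrm{tot}}+1)$, and $S_{\max}=N_e/2$. Ground states in the limits: a fixed state $|\Phi\rangle$ (independent of $s,U$)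 is a finite-energy state if $\lim_{s\uparrow\infty}\lim_{U\uparrow\infty}\langle\Phi|H|\Phi\rangle<\infty$. The ground states in the limits $U\uparrow\infty$, $s\uparrow\infty$ are the normalized $N_e$-electron states minimizing this limiting energy. *)

(* Defs.v *)
From HB Require Import structures.
From mathcomp Require Import all_boot all_order all_algebra.
From mathcomp Require Import all_classical all_reals all_analysis.
From mathcomp Require Import complex.
Set Implicit Arguments.
Unset Strict Implicit.
Unset Printing Implicit Defensive.
Import Order.TTheory GRing.Theory Num.Theory.
Local Open Scope ring_scope.

(* Fermionic Fock space over a finite set T of one-particle modes.     *)
(* A state is a coefficient function on the occupation basis           *)
(* |S> (S : {set T} = set of occupied modes), with the Jordan-Wigner    *)
(* ordering of modes given by enum_rank:                                *)
(*   |S> = c^dag_{m_1} ... c^dag_{m_k} |vac>,  m_1 < ... < m_k.         *)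
Section Fock.
Variables (K : numClosedFieldType) (T : finType).

Definition state := {set T} -> K.

Definition fsign (m : T) (S : {set T}) : K :=
  (-1) ^+ #|[pred m' in S | (enum_rank m' < enum_rank m)%N]|.

Definition cre (m : T) (phi : state) : state :=
  fun S => if m \in S then fsign m (S :\ m) * phi (S :\ m) else 0.

Definition ann (m : T) (phi : state) : state :=
  fun S => if m \in S then 0 else fsign m S * phi (m |: S).

Definition numop (m : T) (phi : state) : state := cre m (ann m phi).

Definition vac : state := fun S => (S == finset.set0)%:R.

Definition inner (phi psi : state) : K := \sum_S (phi S)^* * psi S.

Definition is_Nstate (N : nat) (phi : state) : Prop :=
  forall S : {set T}, #|S| != N -> phi S = 0.

Definition normalized (phi : state) : Prop := inner phi phi = 1.
End Fock.

Section Hubbard.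
Variables (R : realType) (M : finType) (B : {set M * M}).

Definition Erel : rel M := fun x y => ((x, y) \in B) || ((y, x) \in B).

Definition bond := {p : M * M | p \in B}.

(* Lambda = M + O + Obar : inr (e, false) is u(e), inr (e, true) is ubar(e) *)
Definition site := (M + bond * bool)%type.

(* one-particle modes (z, sigma); sigma = true is up, false is down *)
Definition mode := (site * bool)%type.

Local Notation C := R[i].
Local Notation st := (state C mode).

(* coefficients of a_{x,sigma} in terms of c_{z,sigma} *)
Definition acoef (zeta : nat) (mu : R) (x : M) (z : site) : C :=
  (((Num.sqrt (1 + 2 * zeta%:R * mu ^+ 2))^-1)%:C)%C *
  match z with
  | inl y => (y == x)%:R
  | inr (e, false) =>
      (mu%:C)%C * ((val e).1 == x)%:R + (mu%:C)%C * ((val e).2 == x)%:R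
  | inr (e, true) =>
      - ((mu%:C)%C * ((val e).1 == x)%:R) + (mu%:C)%C * ((val e).2 == x)%:R
  end.

(* coefficients of b_{v,sigma}, v in O \cup Obar *)
Definition bcoef (mu : R) (v : bond * bool) (z : site) : C :=
  match z with
  | inr w => (w == v)%:R
  | inl x =>
      let e := val v.1 in
      if v.2 then (* ubar(x,y): c_ubar + mu (c_x - c_y) *)
        (mu%:C)%C * ((x == e.1)%:R - (x == e.2)%:R)
      else        (* u(x,y): c_u - mu (c_x + c_y) *)
        - ((mu%:C)%C * ((x == e.1)%:R + (x == e.2)%:R))
  end.

Definition annL (w : site -> C) (sigma : bool) (phi : st) : st :=
  fun S => \sum_z w z * ann (z, sigma) phi S.
Definition creL (w : site -> C) (sigma : bool) (phi : st) : st :=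
  fun S => \sum_z (w z)^* * cre (z, sigma) phi S.

Definition Ham (zeta : nat) (mu t s U : R) (phi : st) : st :=
  fun S =>
    (t%:C)%C * (\sum_x \sum_(y | Erel x y) \sum_(sigma : bool)
              creL (acoef zeta mu x) sigma (annL (acoef zeta mu y) sigma phi) S)
  + (s%:C)%C * (\sum_(v : bond * bool) \sum_(sigma : bool)
              creL (bcoef mu v) sigma (annL (bcoef mu v) sigma phi) S)
  + (U%:C)%C * (\sum_(z : site) numop (z, true) (numop (z, false) phi) S).

(* <phi|H|phi> (a real number since H is Hermitian) *)
Definition energy (zeta : nat) (mu t : R) (phi : st) (s U : R) : R :=
  complex.Re (inner phi (Ham zeta mu t s U phi)).

Definition limU_energy (zeta : nat) (mu t : R) (phi : st) (s : R) : \bar R :=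
  lim (((energy zeta mu t phi s U)%:E @[U --> +oo])%classic).
Definition lim_energy (zeta : nat) (mu t : R) (phi : st) : \bar R :=
  lim ((limU_energy zeta mu t phi s @[s --> +oo])%classic).

Definition finite_energy (zeta : nat) (mu t : R) (phi : st) : Prop :=
  (lim_energy zeta mu t phi < +oo)%E.

Definition ground_state (zeta : nat) (mu t : R) (N : nat) (phi : st) : Prop :=
  [/\ is_Nstate N phi, normalized phi &
      forall psi : st, is_Nstate N psi -> normalized psi ->
        (lim_energy zeta mu t phi <= lim_energy zeta mu t psi)%E].

Definition Splus (z : site) (phi : st) : st := cre (z, true) (ann (z, false) phi).
Definition Sminus (z : site) (phi : st) : st := cre (z, false) (ann (z, true) phi).
Definition S3 (z : site) (phi : st) : st :=
  fun S => 2^-1 * (numop (z, true) phi S - numop (z, false) phi S).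
Definition S1 (z : site) (phi : st) : st :=
  fun S => (Splus z phi S + Sminus z phi S) / 2.
Definition S2 (z : site) (phi : st) : st :=
  fun S => (Splus z phi S - Sminus z phi S) / (2 * 'i%C).

Definition Stot (Sa : site -> st -> st) (phi : st) : st :=
  fun S => \sum_z Sa z phi S.

Definition Stot2 (phi : st) : st :=
  fun S => Stot S1 (Stot S1 phi) S + Stot S2 (Stot S2 phi) S
         + Stot S3 (Stot S3 phi) S.

End Hubbard.

(* Main.v *)
(* The limits in U and s force b_v phi = 0 and forbid double occupancy.  A state
   with b_v phi = 0 is determined by its coefficients on subsets of the sites M,
   since b_u phi = 0 trades a mode at u for the two modes at the ends of its bond.
   With #|M| electrons those subsets are spin configurations on M, and no double
   occupancy at u(x,y) gives c_(x,down) c_(y,up) phi = c_(x,up) c_(y,down) phi,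
   i.e. symmetry under exchange of neighbouring spins.  By connectedness only the
   number k of up spins matters, so phi is the orbital state prod_x a^dag_x |vac>
   of spinless fermions, annihilated by every b_v because a_x and b_v are
   orthogonal, times a symmetric spin function c(k).  Conversely all such states
   are allowed; they have total spin #|M|/2, and zero hopping energy because all
   the orbitals a_x are filled. *)
Require Import Defs.
From HB Require Import structures.
From mathcomp Require Import all_boot all_order all_algebra.
From mathcomp Require Import all_classical all_reals all_analysis.
From mathcomp Require Import complex.
From mathcomp Require Import ring zify fingroup perm.
(* Again, since classical_sets and boolp shadow many of their lemmas. *)
From mathcomp Require Import fintype finset.
Set Implicit Arguments.
Unset Strict Implicit.
Unset Printing Implicit Defensive.
Import Order.TTheory GRing.Theory Num.Theory.
Local Open Scope ring_scope.

(** * Canonical anticommutation relations *)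

Section FockSpace.
Variables (K : numClosedFieldType) (T : finType).
Implicit Types (m : T) (S : {set T}) (phi psi : state K T) (w v : T -> K).

Lemma fsign_sq m S : fsign K m S * fsign K m S = 1.
Proof. by rewrite /fsign -expr2 sqrr_sign. Qed.

Lemma fsign_neq0 m S : fsign K m S != 0.
Proof. by rewrite /fsign signr_eq0. Qed.

Lemma fsign_conj m S : (fsign K m S)^* = fsign K m S.
Proof. by rewrite /fsign rmorphXn rmorphN1. Qed.

Lemma fsignU m m' S : m' \notin S ->
  fsign K m (m' |: S) = (-1) ^+ (enum_rank m' < enum_rank m)%N * fsign K m S.
Proof.
move=> m'S; rewrite /fsign -exprD; congr (_ ^+ _).
have cU (p : pred T) : #|[pred i in m' |: S | p i]| = (p m' + #|[pred i in S | p i]|)%N.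
  rewrite (cardD1 m') !inE eqxx; congr (_ + _)%N; apply: eq_card => i.
  by rewrite !inE; case: eqVneq => [->|] //=; rewrite (negbTE m'S).
exact: (cU (fun i => enum_rank i < enum_rank m)%N).
Qed.

Lemma rank_lt_neq m m' : m != m' ->
  (enum_rank m < enum_rank m')%N = ~~ (enum_rank m' < enum_rank m)%N.
Proof.
move=> ne; rewrite -leqNgt ltn_neqAle.
by rewrite (inj_eq (@ord_inj _)) (inj_eq (@enum_rank_inj T)) (negbTE ne).
Qed.

(** Of two distinct modes exactly one precedes the other, so exactly one of the two orders of
    insertion picks up an extra factor -1. *)
Lemma fsign_swap m m' S : m != m' -> m \notin S -> m' \notin S ->
  fsign K m S * fsign K m' (m |: S) = - (fsign K m' S * fsign K m (m' |: S)).
Proof.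
move=> ne mS m'S; rewrite !fsignU // (rank_lt_neq ne).
by case: (_ < _)%N => /=; rewrite ?expr0 ?expr1; ring.
Qed.

Lemma ann_ann m m' phi S : ann m (ann m' phi) S = - ann m' (ann m phi) S.
Proof.
rewrite /ann; case: (eqVneq m m') => [->|ne].
  by rewrite setU11; case: ifP => _; rewrite ?mulr0 oppr0.
rewrite !in_setU1 (negbTE ne) (eq_sym m') (negbTE ne) /=.
case: ifPn => mS; case: ifPn => m'S; rewrite ?mulr0 ?oppr0 // !mulrA.
by rewrite fsign_swap // setUCA mulNr.
Qed.

Lemma ann_cre m m' phi S :
  ann m (cre m' phi) S + cre m' (ann m phi) S = (m == m')%:R * phi S.
Proof.
rewrite /ann /cre; case: (eqVneq m m') => [->|ne].
  rewrite setU11 setD11; case: ifPn => mS.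
    by rewrite setD1K // add0r mulrA fsign_sq.
  by rewrite addr0 setU1K // mulrA fsign_sq.
rewrite !inE (negbTE ne) (eq_sym m') (negbTE ne) /= mul0r.
case: ifPn => mS; case: ifPn => m'S; rewrite ?mulr0 ?addr0 //.
have -> : (m |: S) :\ m' = m |: (S :\ m').
  apply/setP => i; rewrite !inE; case: (eqVneq i m') => //= ->.
  by rewrite eq_sym (negbTE ne).
rewrite !mulrA -mulrDl.
have mS' : m \notin S :\ m' by rewrite !inE (negbTE mS) andbF.
have m'S' : m' \notin S :\ m' by rewrite !inE eqxx.
have e : fsign K m S = _ := etrans (congr1 (fsign K m) (esym (setD1K m'S))) (fsignU m m'S').
rewrite e fsignU // (rank_lt_neq ne).
by case: (_ < _)%N => /=; rewrite ?expr0 ?expr1; ring.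
Qed.

Definition annW w phi : state K T := fun S => \sum_m w m * ann m phi S.
Definition creW w phi : state K T := fun S => \sum_m (w m)^* * cre m phi S.

Lemma ann_sum (I : finType) m (c : I -> K) (phi : I -> state K T) S :
  ann m (fun S => \sum_i c i * phi i S) S = \sum_i c i * ann m (phi i) S.
Proof.
rewrite /ann; case: ifP => _; first by rewrite big1 // => i _; rewrite mulr0.
by rewrite mulr_sumr; apply: eq_bigr => i _; rewrite mulrCA.
Qed.

Lemma cre_sum (I : finType) m (c : I -> K) (phi : I -> state K T) S :
  cre m (fun S => \sum_i c i * phi i S) S = \sum_i c i * cre m (phi i) S.
Proof.
rewrite /cre; case: ifP => _; last by rewrite big1 // => i _; rewrite mulr0.
by rewrite mulr_sumr; apply: eq_bigr => i _; rewrite mulrCA.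
Qed.

Lemma annW_creW w v phi S :
  annW w (creW v phi) S + creW v (annW w phi) S =
  (\sum_m w m * (v m)^*) * phi S.
Proof.
rewrite /annW /creW.
under eq_bigr do rewrite ann_sum mulr_sumr.
under [X in _ + X]eq_bigr do rewrite cre_sum mulr_sumr.
rewrite [X in _ + X]exchange_big -big_split mulr_suml.
apply: eq_bigr => m _ /=; rewrite -big_split /=.
under eq_bigr do rewrite [X in _ + X]mulrCA -!mulrDr ann_cre.
rewrite (bigD1 m) //= eqxx mul1r big1 ?addr0 ?mulrA // => m' ne.
by rewrite eq_sym (negbTE ne) mul0r !mulr0.
Qed.

Lemma inner_cre m phi psi : inner (cre m phi) psi = inner phi (ann m psi).
Proof.
rewrite /inner (bigID (fun S => m \in S)) /= [X in _ + X]big1 ?addr0; last first.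
  by move=> S mS; rewrite /cre (negbTE mS) rmorph0 mul0r.
rewrite [RHS](bigID (fun S => m \notin S)) /= [X in _ = _ + X]big1 ?addr0; last first.
  by move=> S; rewrite negbK /ann => ->; rewrite mulr0.
(* Only sets containing [m] contribute on the left and only sets avoiding [m] on the right;
   inserting [m] matches them. *)
rewrite (reindex_onto (fun S => m |: S) (fun S => S :\ m)) /=; last first.
  by move=> S; apply: setD1K.
apply: eq_big => [S|S].
  rewrite setU11 /=; apply/eqP/idP => [<-|]; first by rewrite setD11.
  exact: setU1K.
move=> /andP[_ /eqP e]; rewrite /cre setU11 e /ann.
have /negbTE -> : m \notin S by rewrite -e setD11.
by rewrite rmorphM /= fsign_conj; ring.
Qed.

Lemma inner_conj phi psi : (inner phi psi)^* = inner psi phi.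
Proof.
rewrite /inner rmorph_sum; apply: eq_bigr => S _.
by rewrite rmorphM /= conjCK mulrC.
Qed.

Lemma inner_sumr (I : finType) (P : pred I) phi (psi : I -> state K T) :
  inner phi (fun S => \sum_(i | P i) psi i S) = \sum_(i | P i) inner phi (psi i).
Proof.
rewrite /inner; under eq_bigr do rewrite mulr_sumr.
by rewrite exchange_big.
Qed.

Lemma innerZr a phi psi : inner phi (fun S => a * psi S) = a * inner phi psi.
Proof. by rewrite /inner mulr_sumr; apply: eq_bigr => S _; rewrite mulrCA. Qed.

Lemma innerDr phi psi psi' :
  inner phi (fun S => psi S + psi' S) = inner phi psi + inner phi psi'.
Proof. by rewrite /inner -big_split; apply: eq_bigr => S _; rewrite mulrDr. Qed.

Lemma inner_creW w phi psi : inner phi (creW w psi) = inner (annW w phi) psi.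
Proof.
rewrite -[RHS]inner_conj /annW /creW !inner_sumr rmorph_sum.
apply: eq_bigr => m _; rewrite !innerZr rmorphM /= -inner_cre; congr (_ * _).
by rewrite inner_conj.
Qed.

Lemma inner_ge0 phi : 0 <= inner phi phi.
Proof. by apply: sumr_ge0 => S _; rewrite mulrC mul_conjC_ge0. Qed.

Lemma inner_eq0 phi : inner phi phi = 0 -> phi = fun=> 0.
Proof.
move/eqP; rewrite /inner psumr_eq0; last by move=> S _; rewrite mulrC mul_conjC_ge0.
move=> /allP h; apply/funext => S; apply/eqP.
by have := h S (mem_index_enum _); rewrite mulrC mul_conjC_eq0.
Qed.

Lemma numopE m phi S : numop m phi S = (m \in S)%:R * phi S.
Proof.
rewrite /numop /cre /ann; case: ifP => mS; last by rewrite mul0r.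
by rewrite setD11 setD1K // mulrA fsign_sq.
Qed.

Lemma is_Nstate_ann N m phi : is_Nstate N phi -> is_Nstate N.-1 (ann m phi).
Proof.
move=> hN S nS; rewrite /ann; case: ifPn => // mS; rewrite hN ?mulr0 //.
by rewrite cardsU1 mS add1n; apply: contraNneq nS => <-.
Qed.

Lemma is_Nstate_annW N w phi : is_Nstate N phi -> is_Nstate N.-1 (annW w phi).
Proof.
by move=> hN S nS; apply: big1 => m _; rewrite (is_Nstate_ann m hN nS) mulr0.
Qed.

Lemma is_Nstate_creW N w phi : is_Nstate N phi -> is_Nstate N.+1 (creW w phi).
Proof.
move=> hN S nS; apply: big1 => m _; rewrite /cre; case: ifPn => [mS|]; rewrite ?mulr0 //.
by rewrite hN ?mulr0 //; apply: contraNneq nS => <-; rewrite (cardsD1 m) mS.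
Qed.

Lemma annW_vac w : annW w (@vac K T) = fun=> 0.
Proof.
apply/funext => S; apply: big1 => m _; rewrite /ann /vac; case: ifP => _; rewrite ?mulr0 //.
case: eqP => [/setP/(_ m)|_]; last by rewrite !mulr0.
by rewrite setU11 inE.
Qed.

Lemma ann0 m : ann m (fun=> 0 : K) = fun=> 0.
Proof. by apply/funext => S; rewrite /ann mulr0 if_same. Qed.

Lemma cre0 m : cre m (fun=> 0 : K) = fun=> 0.
Proof. by apply/funext => S; rewrite /cre mulr0 if_same. Qed.

Lemma creW0 w : creW w (fun=> 0) = fun=> 0.
Proof.
by apply/funext => S; apply: big1 => m _; rewrite cre0 mulr0.
Qed.

(* [b m] expresses the annihilator of the mode [m] outside [P] through the
   modes in [P], so coefficients on sets leaving [P] reduce to those on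
   subsets of [P]. *)
Lemma annW_ker_eq0 (P : pred T) (b : T -> T -> K) phi :
  (forall m, ~~ P m -> b m m = 1) ->
  (forall m m', ~~ P m -> ~~ P m' -> m != m' -> b m m' = 0) ->
  (forall m, ~~ P m -> annW (b m) phi = fun=> 0) ->
  (forall S : {set T}, {subset S <= P} -> phi S = 0) ->
  forall S, phi S = 0.
Proof.
move=> b1 b0 ker ini S; have [n] := ubnP #|[set m in S | ~~ P m]|.
elim: n S => // n IH S ltn.
have [m /andP[mS nP]|none] := pickP [pred m in S | ~~ P m]; last first.
  apply: ini => m mS; have := none m; rewrite /= mS /=.
  by move/negbFE.
(* At [S :\ m] the kernel equation isolates [phi S] up to a sign. The other surviving terms replace
   [m] by a mode in [P], which lowers the number of modes outside [P]. *)
have := congr1 (fun f : state K T => f (S :\ m)) (ker m nP).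
rewrite /annW (bigD1 m) //= b1 // mul1r big1 => [|m' ne].
  rewrite addr0 /ann setD11 setD1K // => /eqP.
  by rewrite mulf_eq0 (negbTE (fsign_neq0 _ _)) => /eqP.
have [Pm'|nPm'] := boolP (P m'); last by rewrite b0 ?mul0r // eq_sym.
rewrite /ann; case: ifP => _; rewrite ?mulr0 // IH ?mulr0 //.
have lt : (#|[set i in m' |: (S :\ m) | ~~ P i]| < #|[set i in S | ~~ P i]|)%N.
  rewrite [X in (_ < X)%N](cardsD1 m) !inE mS nP ltnS subset_leq_card //.
  apply/subsetP => i; rewrite !inE => /andP[/orP[/eqP->|/andP[-> ->]] //].
  by rewrite Pm'.
exact: leq_trans lt ltn.
Qed.

End FockSpace.

(** * Orbital states times symmetric spin functions *)

Lemma index_pairs (T1 T2 : eqType) (s : seq T1) (t : seq T2) x y :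
  x \in s -> y \in t ->
  index (x, y) [seq (a, b) | a <- s, b <- t] = (index x s * size t + index y t)%N.
Proof.
move=> + yt; elim: s => //= a s IH.
have mem_a : ((x, y) \in [seq (a, b) | b <- t]) = (x == a).
  apply/mapP/eqP => [[b _ [-> _]] //|->]; by exists y.
rewrite index_cat mem_a in_cons size_map; case: eqVneq => [->|ne] //= xs.
  by rewrite mul0n index_map // => b c [].
by rewrite IH // mulSn addnA.
Qed.

Lemma enum_rankE (T : finType) (x : T) : enum_rank x = index x (enum T) :> nat.
Proof.
rewrite -[in RHS](nth_enum_rank x x) index_uniq ?enum_uniq //.
by rewrite -cardE ltn_ord.
Qed.

(** Pairs are enumerated lexicographically, first component first. Hence the Jordan-Wigner order of
    modes at different sites ignores the spins. *)
Lemma enum_rank_pair (Z Y : finType) (z z' : Z) (y y' : Y) : z != z' ->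
  (enum_rank (z, y) < enum_rank (z', y'))%N = (enum_rank z < enum_rank z')%N.
Proof.
move=> ne.
have E (a : Z) (b : Y) : (enum_rank (a, b) = enum_rank a * #|Y| + enum_rank b :> nat)%N.
  rewrite !enum_rankE cardE -index_pairs ?mem_enum //.
  by rewrite (enumT (Z * Y)%type) unlock.
rewrite !E; have := ltn_ord (enum_rank y); have := ltn_ord (enum_rank y').
have : (enum_rank z != enum_rank z' :> nat) by rewrite (inj_eq (@ord_inj _)) (inj_eq enum_rank_inj).
move: (nat_of_ord (enum_rank z)) (nat_of_ord (enum_rank z')) => a a'.
move: (nat_of_ord (enum_rank y)) (nat_of_ord (enum_rank y')) => b b'.
move: #|Y| => n ne' lb' lb.
by apply/idP/idP; nia.
Qed.

Section SpinLift.
Variables (K : numClosedFieldType) (Z : finType).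
Implicit Types (z : Z) (s : bool) (S : {set Z * bool}) (psi : state K Z)
  (c : nat -> K).

Definition nodbl S := [forall z, ~~ (((z, true) \in S) && ((z, false) \in S))].
Definition sites S : {set Z} := [set m.1 | m in S].
Definition nup S := #|[set z | (z, true) \in S]|.

(* The orbital wave function [psi] times the spin function giving weight [c k]
   to each configuration with [k] up spins; a spin function symmetric under
   permutations of the electrons keeps the product antisymmetric. *)
Definition lift c psi : state K (Z * bool)%type :=
  fun S => if nodbl S then c (nup S) * psi (sites S) else 0.

Lemma sitesP z S : reflect (exists s, (z, s) \in S) (z \in sites S).
Proof.
apply: (iffP imsetP) => [[[z' s] mS ->]|[s zS]]; first by exists s.
by exists (z, s).
Qed.

Lemma sitesE z S : (z \in sites S) = ((z, true) \in S) || ((z, false) \in S).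
Proof.
by apply/sitesP/orP => [[[] ->]|[] ?]; [left|right|exists true|exists false].
Qed.

Lemma nodblP S : reflect (forall z s, (z, s) \in S -> (z, ~~ s) \notin S) (nodbl S).
Proof.
apply: (iffP forallP) => h z; last by apply/andP => -[/h /negP].
by move=> s; have := h z; case: s; case: (_ \in S) => //= /negbTE ->.
Qed.

Lemma nodblU z s S : (z, s) \notin S ->
  nodbl ((z, s) |: S) = nodbl S && (z \notin sites S).
Proof.
move=> nzS; apply/nodblP/andP => [h|[/nodblP h]].
  split.
    apply/nodblP => z' s' z'S; have := h z' s'.
    by rewrite !inE z'S orbT negb_or => /(_ isT)/andP[].
  have := h z s; rewrite setU11 !inE negb_or => /(_ isT)/andP[_].
  by rewrite sitesE; case: s nzS {h} => /= /negbTE -> // /negbTE ->.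
rewrite sitesE negb_or => /andP[n1 n2] z' s'.
rewrite !inE => /orP[/eqP[-> ->]|z'S].
  by rewrite xpair_eqE eqxx /=; case: (s); rewrite /= ?n1 ?n2.
rewrite negb_or h // andbT; apply: contraTneq z'S => -[-> _].
by case: s'.
Qed.

Lemma sitesU z s S : sites ((z, s) |: S) = z |: sites S.
Proof. by rewrite /sites imsetU1. Qed.

Lemma nupU z s S : (z, s) \notin S -> nup ((z, s) |: S) = (s + nup S)%N.
Proof.
move=> nzS; rewrite /nup; case: s nzS => nzS /=.
  have -> : [set z0 | (z0, true) \in (z, true) |: S] = z |: [set z0 | (z0, true) \in S].
    by apply/setP => z'; rewrite !inE xpair_eqE eqxx andbT.
  by rewrite cardsU1 inE nzS.
by congr #|pred_of_set _|; apply/setP => z'; rewrite !inE xpair_eqE andbF.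
Qed.

Lemma nodbl_inj S : nodbl S -> {in S &, injective (fun m : Z * bool => m.1)}.
Proof.
move=> /nodblP h [z s] [z' s'] mS m'S /= e; subst z'.
by have := h _ _ mS; case: s s' mS m'S => [] [] // _ ->.
Qed.

Lemma card_sites S : nodbl S -> #|sites S| = #|S|.
Proof. by move=> /nodbl_inj inj; rewrite /sites card_in_imset. Qed.

(** Without double occupancy, forgetting the spin is injective on [S], and it respects the order
    relative to the empty site [z]; so as many modes precede as sites. *)
Lemma fsign_sites z s S : nodbl S -> z \notin sites S ->
  fsign K (z, s) S = fsign K z (sites S).
Proof.
move=> nd zS; rewrite /fsign; congr (_ ^+ _).
have inj : {in [set m in S | (enum_rank m.1 < enum_rank z)%N] &,
    injective (fun m : Z * bool => m.1)}.
  by move=> m m'; rewrite !inE => /andP[mS _] /andP[m'S _]; exact: nodbl_inj nd _ _ mS m'S.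
transitivity #|[set m in S | (enum_rank m.1 < enum_rank z)%N]|.
  apply: eq_card => -[z' s']; rewrite !inE /=.
  case: (boolP (_ \in S)) => //= mS; rewrite enum_rank_pair //.
  by apply: contraNneq zS => <-; apply/sitesP; exists s'.
rewrite -(card_in_imset inj); apply: eq_card => z'; rewrite !inE.
apply/imsetP/andP => [[m]|[/sitesP[s' mS] lt]].
  by rewrite inE => /andP[mS lt] ->; split=> //; apply/imsetP; exists m.
by exists (z', s'); rewrite ?inE ?mS.
Qed.

(** The coefficient at [S] is read off at [(z, s) |: S], which has one more up spin exactly when [s]
    is [true], that is, 1 as a number. *)
Lemma ann_lift z s c psi :
  ann (z, s) (lift c psi) = lift (fun k => c (s + k)%N) (ann z psi).
Proof.
apply/funext => S; rewrite /lift /ann.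
case: ifPn => zS.
  have -> : z \in sites S by apply/sitesP; exists s.
  by rewrite mulr0 if_same.
rewrite nodblU //; case: (boolP (nodbl S)) => nd /=; last by rewrite mulr0.
case: (boolP (z \in sites S)) => zs /=; first by rewrite !mulr0.
by rewrite nupU // sitesU fsign_sites // mulrCA.
Qed.

(** Replacing a spin at [z] keeps the set of occupied sites, so the two signs cancel and only the
    number of up spins changes. The truncated [k - s] is harmless, since [(z, s)] lies in [S]
    whenever the factor in front is nonzero. *)
Lemma cre_ann_lift z s s' c psi S :
  cre (z, s) (ann (z, s') (lift c psi)) S =
  ((z, s) \in S)%:R * lift (fun k => c (s' + (k - s))%N) psi S.
Proof.
rewrite ann_lift /cre; case: ifPn => zS; rewrite ?mul0r // mul1r.
have zS' : (z, s) \notin S :\ (z, s) by rewrite setD11.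
have := nodblU zS'; have := sitesU z s (S :\ (z, s)); have := nupU zS'.
rewrite setD1K // /lift /ann => -> -> ->.
case: (boolP (nodbl _)) => nd /=; last by rewrite mulr0.
case: ifPn => zs; rewrite ?mulr0 //=.
by rewrite (fsign_sites s nd zs) mulrCA (mulrA (fsign _ _ _)) fsign_sq mul1r addKn.
Qed.

Lemma is_Nstate_lift N c psi : is_Nstate N psi -> is_Nstate N (lift c psi).
Proof.
move=> hN S nS; rewrite /lift; case: ifP => // nd.
by rewrite hN ?mulr0 // card_sites.
Qed.

Lemma card_nup_ndown S : #|S| = (nup S + #|[set z | (z, false) \in S]|)%N.
Proof.
have inj s : injective (fun z => (z, s)) by move=> ? ? [].
rewrite /nup -(card_imset _ (inj true)) -(card_imset _ (inj false)).
rewrite -cardsUI [X in (_ + X)%N](_ : _ = 0%N) ?addn0.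
  apply: eq_card => -[z s]; rewrite inE; apply/idP/orP.
    by case: s => h; [left|right]; apply: imset_f; rewrite inE.
  by move=> [] /imsetP[z']; rewrite inE => + [-> ->].
apply: eq_card0 => -[z s]; rewrite inE; apply/negP => /andP[/imsetP[? _ [_ ->]]].
by move=> /imsetP[].
Qed.

Lemma lift_sum (I : finType) (d : I -> K) (c : I -> nat -> K) psi S :
  \sum_i d i * lift (c i) psi S = lift (fun k => \sum_i d i * c i k) psi S.
Proof.
rewrite /lift; case: ifP => _; last by rewrite big1 // => i _; rewrite mulr0.
by rewrite mulr_suml; apply: eq_bigr => i _; rewrite mulrA.
Qed.

Lemma eq_lift N c c' psi : is_Nstate N psi ->
  (forall k, (k <= N)%N -> c k = c' k) -> lift c psi = lift c' psi.
Proof.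
move=> hN e; apply/funext => S; rewrite /lift; case: ifP => // nd.
have [eN|/eqP ne] := eqVneq #|S| N; last by rewrite hN ?mulr0 //; apply/eqP; rewrite card_sites.
by rewrite e // -eN card_nup_ndown leq_addr.
Qed.

(** Each set of [N] sites carries 'C(N, k) configurations with [k] up spins, whatever the set, so
    the spin sum factors out. The value of [kappa] is hidden because the lemma serves to transfer
    orthogonality from orbital states to lifts. *)
Lemma inner_lift N c c' : exists kappa, forall psi psi',
  is_Nstate N psi -> inner (lift c psi) (lift c' psi') = kappa * inner psi psi'.
Proof.
exists (\sum_(k < N.+1) 'C(N, k)%:R * ((c k)^* * c' k)) => psi psi' hN.
rewrite /inner (partition_big (fun S => sites S) predT) //= mulr_sumr.
apply: eq_bigr => X _.
have [eN|neN] := eqVneq #|X| N; last first.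
  rewrite (hN X neN) rmorph0 mul0r mulr0 big1 // => S /eqP e.
  by rewrite /lift; case: ifP => _; rewrite ?rmorph0 ?mul0r // e (hN X neN) mulr0 rmorph0 mul0r.
rewrite (bigID nodbl) /= [X in _ + X]big1 ?addr0; last first.
  by move=> S /andP[_ /negbTE nd]; rewrite /lift nd mulr0.
transitivity (\sum_(U : {set Z} | U \subset X) ((c #|U|)^* * c' #|U|) * ((psi X)^* * psi' X)).
  (* Configurations without double occupancy on the site set [X] correspond to their sets [U] of up
     sites. *)
  rewrite (reindex_onto (fun U : {set Z} => [set m | (m.1 \in X) && (m.2 == (m.1 \in U))])
     (fun S => [set z | (z, true) \in S])) /=.
    apply: eq_big => [U|U].
      apply/idP/idP => [/andP[_ /eqP <-]|UX].
        by apply/subsetP => z; rewrite !inE => /andP[].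
      apply/andP; split; [apply/andP; split|].
      - apply/eqP/setP => z; rewrite sitesE !inE /=.
        by case: (z \in X); case: (z \in U).
      - by apply/nodblP => z s; rewrite !inE /=; case: (z \in X); case: (z \in U); case: s.
      - apply/eqP/setP => z; rewrite !inE /=; case: (boolP (z \in U)) => [/(subsetP UX) ->|] //=.
        by rewrite andbF.
    move=> /andP[/andP[/eqP sX nd] /eqP eU].
    rewrite /lift nd sX /nup eU rmorphM /=; ring.
  move=> S /andP[/eqP sX /nodblP nd]; apply/setP => -[z s]; rewrite !inE /= -sX sitesE.
  have := nd z s; case: s; case: (boolP ((z, true) \in S)); case: (boolP ((z, false) \in S)) => //=.
  by move=> _ _ /(_ isT).
rewrite -mulr_suml; congr (_ * _).
rewrite (partition_big (fun U : {set Z} => inord #|U| : 'I_N.+1) predT) //=.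
apply: eq_bigr => k _.
have E (U : {set Z}) : U \subset X -> (inord #|U| == k) = (#|U| == k :> nat).
  move=> UX; rewrite -(inj_eq (@ord_inj _)) inordK // ltnS -eN.
  exact: subset_leq_card.
transitivity (\sum_(U : {set Z} | (U \subset X) && (#|U| == k)) (c k)^* * c' k).
  apply: eq_big => U; first by case: (boolP (U \subset X)) => // /E ->.
  by move=> /andP[/E -> /eqP ->].
rewrite sumr_const -[LHS]mulr_natl; congr (_%:R * _).
by move: (k : nat) => j; rewrite -eN -cards_draws; apply: eq_card => U; rewrite !inE.
Qed.

End SpinLift.

(** * The limits of the energy *)

Section SpinfulWeights.
Variables (R : realType) (M : finType) (B : {set M * M}).
Local Notation C := R[i].
Implicit Types (w v : site B -> C) (phi : state C (mode B)) (sigma : bool).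

Definition spinw w sigma (m : mode B) : C := (m.2 == sigma)%:R * w m.1.

Lemma sum_spinw sigma (F : mode B -> C) :
  \sum_(m : mode B) (m.2 == sigma)%:R * F m = \sum_z F (z, sigma).
Proof.
transitivity (\sum_(z : site B) \sum_(s : bool) (s == sigma)%:R * F (z, s)).
  by rewrite pair_bigA; apply: eq_bigr => -[].
apply: eq_bigr => z _; rewrite (bigD1 sigma) //= eqxx mul1r big1 ?addr0 // => s.
by move=> /negbTE ->; rewrite mul0r.
Qed.

Lemma annLE w sigma phi : annL w sigma phi = annW (spinw w sigma) phi.
Proof.
apply/funext => S; rewrite /annW /spinw /annL.
rewrite -(sum_spinw sigma (fun m => w m.1 * ann m phi S)).
by apply: eq_bigr => m _; rewrite mulrA.
Qed.

Lemma creLE w sigma phi : creL w sigma phi = creW (spinw w sigma) phi.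
Proof.
apply/funext => S; rewrite /creW /spinw /creL.
rewrite -(sum_spinw sigma (fun m => (w m.1)^* * cre m phi S)).
by apply: eq_bigr => m _; rewrite rmorphM /= rmorph_nat mulrA.
Qed.

Lemma annL_lift w sigma c psi :
  annL w sigma (lift c psi) = lift (fun k => c (sigma + k)%N) (annW w psi).
Proof.
apply/funext => S; rewrite /annL; under eq_bigr do rewrite ann_lift.
rewrite /lift /annW; case: ifP => _; last by rewrite big1 // => z _; rewrite mulr0.
by rewrite mulr_sumr; apply: eq_bigr => z _; rewrite mulrCA.
Qed.

End SpinfulWeights.

Lemma ReD (R : realType) (x y : R[i]) :
  complex.Re (x + y) = complex.Re x + complex.Re y.
Proof. by case: x y => [? ?] [? ?]. Qed.

Lemma ReZ (R : realType) (r : R) (x : R[i]) :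
  complex.Re ((r%:C)%C * x) = r * complex.Re x.
Proof. by case: x => a b /=; rewrite mul0r subr0. Qed.

Lemma lim_affine (R : realType) (a b : R) : 0 <= b ->
  lim (((a + x * b)%:E @[x --> +oo])%classic) = if b == 0 then a%:E else +oo%E.
Proof.
rewrite le_eqVlt => /predU1P[<-|b0].
  rewrite eqxx; under eq_fun do rewrite mulr0 addr0.
  exact: lim_cst.
rewrite gt_eqF //; apply/cvg_lim => //; apply/cvgeryP.
apply/cvgryPge => A; near=> x.
rewrite -lerBlDl -ler_pdivrMr //; near: x.
Unshelve. all: by end_near. Qed.

Section Energy.
Variables (R : realType) (M : finType) (B : {set M * M}) (zeta : nat) (mu t : R).
Local Notation C := R[i].
Implicit Types (phi : state C (mode B)).

Definition hop phi : C := \sum_x \sum_(y | Erel B x y) \sum_(sigma : bool)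
  inner (annL (acoef zeta mu x) sigma phi) (annL (acoef zeta mu y) sigma phi).
Definition bnorm phi : C := \sum_(v : bond B * bool) \sum_(sigma : bool)
  inner (annL (bcoef mu v) sigma phi) (annL (bcoef mu v) sigma phi).
Definition dbl phi : C := \sum_(z : site B)
  inner phi (numop (z, true) (numop (z, false) phi)).

(** Moving creation operators to the left factor turns the [s] term into a sum of squared norms. The
    energy is thus affine in [s] and in [U], with slopes shown nonnegative below. *)
Lemma energyE phi s U : energy zeta mu t phi s U =
  t * complex.Re (hop phi) + s * complex.Re (bnorm phi) + U * complex.Re (dbl phi).
Proof.
rewrite /energy -!ReZ -!ReD; congr complex.Re.
rewrite /Ham 2!innerDr !innerZr !inner_sumr.
congr (_ * _ + _ * _ + _).
  apply: eq_bigr => x _; rewrite inner_sumr; apply: eq_bigr => y _.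
  rewrite inner_sumr; apply: eq_bigr => sigma _.
  by rewrite creLE inner_creW !annLE.
apply: eq_bigr => v _; rewrite inner_sumr; apply: eq_bigr => sigma _.
by rewrite creLE inner_creW !annLE.
Qed.

Lemma bnorm_ge0 phi : 0 <= bnorm phi.
Proof. by apply: sumr_ge0 => v _; apply: sumr_ge0 => s _; exact: inner_ge0. Qed.

Lemma dbl_term_ge0 phi z : 0 <= inner phi (numop (z, true) (numop (z, false) phi)).
Proof.
apply: sumr_ge0 => S _; rewrite !numopE.
by do 2 case: (_ \in S); rewrite ?mul0r ?mulr0 // !mul1r mulrC mul_conjC_ge0.
Qed.

Lemma dbl_ge0 phi : 0 <= dbl phi.
Proof. by apply: sumr_ge0 => z _; exact: dbl_term_ge0. Qed.

Lemma Re_ge0 (x : C) : 0 <= x -> 0 <= complex.Re x.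
Proof. by rewrite lecE => /andP[]. Qed.

Lemma Re_eq0 (x : C) : 0 <= x -> (complex.Re x == 0) = (x == 0).
Proof. by rewrite lecE eq_complex => /andP[/= -> _]; rewrite andbT. Qed.

Lemma bnorm_eq0 phi : bnorm phi = 0 <->
  forall v sigma, annL (bcoef mu v) sigma phi = fun=> 0.
Proof.
split=> [/eqP + v s|h]; last first.
  by apply: big1 => v _; apply: big1 => s _; rewrite h /inner big1 // => S _; rewrite mulr0.
have ge0 v' : 0 <= \sum_(s' : bool) inner (annL (bcoef mu v') s' phi) (annL (bcoef mu v') s' phi).
  by apply: sumr_ge0 => ? _; exact: inner_ge0.
rewrite psumr_eq0 // => /allP/(_ v (mem_index_enum _)) /=.
rewrite psumr_eq0; last by move=> ? _; exact: inner_ge0.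
by move=> /allP/(_ s (mem_index_enum _)) /= /eqP/inner_eq0.
Qed.

Lemma dbl_eq0 phi : dbl phi = 0 <-> forall S, ~~ nodbl S -> phi S = 0.
Proof.
split=> [/eqP + S|h].
  rewrite psumr_eq0; last by move=> ? _; exact: dbl_term_ge0.
  move=> /allP h /forallPn[z]; rewrite negbK => /andP[z1 z2].
  have /= := h z (mem_index_enum _); rewrite /inner psumr_eq0; last first.
    move=> S' _; rewrite !numopE.
    by do 2 case: (_ \in S'); rewrite ?mul0r ?mulr0 // !mul1r mulrC mul_conjC_ge0.
  move=> /allP/(_ S (mem_index_enum _)); rewrite !numopE z1 z2 !mul1r /=.
  by rewrite mulrC mul_conjC_eq0 => /eqP.
apply: big1 => z _; apply: big1 => S _; rewrite !numopE.
have [nd|/h ->] := boolP (nodbl S); last by rewrite !mulr0.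
have /forallP/(_ z) := nd.
by do 2 case: (_ \in S); rewrite ?mul0r ?mulr0.
Qed.

(** By the next two lemmas these are exactly the finite-energy states. *)
Definition constrained phi :=
  (forall v sigma, annL (bcoef mu v) sigma phi = fun=> 0) /\
  (forall S, ~~ nodbl S -> phi S = 0).

Lemma lim_energyE phi : constrained phi ->
  lim_energy zeta mu t phi = (t * complex.Re (hop phi))%:E.
Proof.
move=> [/bnorm_eq0 b0 /dbl_eq0 d0]; rewrite /lim_energy /limU_energy.
under eq_fun do under eq_fun do rewrite energyE b0 d0 !mulr0 !addr0.
by rewrite lim_cst // lim_cst.
Qed.

Lemma lim_energy_oo phi : ~ constrained phi -> lim_energy zeta mu t phi = +oo%E.
Proof.
move=> nc; rewrite /lim_energy /limU_energy.
under eq_fun do under eq_fun do rewrite energyE.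
under eq_fun do rewrite lim_affine ?Re_ge0 ?dbl_ge0 // Re_eq0 ?dbl_ge0 //.
(* If double occupancy has positive weight, the limit in [U] is already infinite for every [s];
   otherwise the divergence comes from the [s] term. *)
have [/dbl_eq0 d0|_] := eqVneq (dbl phi) 0; last exact: lim_cst.
rewrite lim_affine ?Re_ge0 ?bnorm_ge0 // Re_eq0 ?bnorm_ge0 //.
by have [/bnorm_eq0 b0|//] := eqVneq (bnorm phi) 0; case: nc.
Qed.

End Energy.

(** * Total spin *)

Section TotalSpin.
Variables (R : realType) (M : finType) (B : {set M * M}) (N : nat).
Local Notation C := R[i].
Variable psi : state C (site B).
Hypothesis psiN : is_Nstate N psi.
Implicit Types (c : nat -> C) (S : {set mode B}).

Lemma sum_mem (Z : finType) (P : pred Z) : \sum_z (P z)%:R = #|[set z | P z]|%:R :> C.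
Proof.
rewrite -sum1_card natr_sum [RHS]big_mkcond; apply: eq_bigr => z _.
by rewrite inE; case: (P z).
Qed.

Lemma nup_lift c S : (nup S)%:R * lift c psi S = lift (fun k => k%:R * c k) psi S.
Proof. by rewrite /lift; case: ifP => _; rewrite ?mulr0 // mulrA. Qed.

Lemma ndown_lift c S : #|[set z | (z, false) \in S]|%:R * lift c psi S =
  lift (fun k => (N%:R - k%:R) * c k) psi S.
Proof.
rewrite /lift; case: ifP => nd; rewrite ?mulr0 // !mulrA.
have [eN|neN] := eqVneq #|S| N; last by rewrite (psiN (S := sites S)) ?mulr0 ?card_sites.
by rewrite -eN card_nup_ndown natrD addrAC subrr add0r.
Qed.

(** Any of the [k] up spins of [S] may be the one just raised, from a configuration with [k.-1] up
    spins. At [k = 0] the default value of [k.-1] is multiplied by zero. *)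
Lemma Splus_lift c S : \sum_z Splus z (lift c psi) S =
  lift (fun k => k%:R * c k.-1) psi S.
Proof.
rewrite /Splus; under eq_bigr do rewrite cre_ann_lift.
rewrite -mulr_suml sum_mem nup_lift; congr (lift _ _ _).
by apply/funext => k; rewrite add0n subn1.
Qed.

Lemma Sminus_lift c S : \sum_z Sminus z (lift c psi) S =
  lift (fun k => (N%:R - k%:R) * c k.+1) psi S.
Proof.
rewrite /Sminus; under eq_bigr do rewrite cre_ann_lift.
rewrite -mulr_suml sum_mem ndown_lift; congr (lift _ _ _).
by apply/funext => k; rewrite subn0.
Qed.

Lemma S1_lift c : Stot (@S1 R M B) (lift c psi) =
  lift (fun k => (k%:R * c k.-1 + (N%:R - k%:R) * c k.+1) / 2) psi.
Proof.
apply/funext => S; rewrite /Stot /S1 -mulr_suml big_split /= Splus_lift Sminus_lift.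
by rewrite /lift; case: ifP => _; ring.
Qed.

Lemma S2_lift c : Stot (@S2 R M B) (lift c psi) =
  lift (fun k => (k%:R * c k.-1 - (N%:R - k%:R) * c k.+1) / (2 * 'i%C)) psi.
Proof.
apply/funext => S; rewrite /Stot /S2 -mulr_suml sumrB Splus_lift Sminus_lift.
by rewrite /lift; case: ifP => _; ring.
Qed.

Lemma S3_lift c : Stot (@S3 R M B) (lift c psi) =
  lift (fun k => (k%:R - N%:R / 2) * c k) psi.
Proof.
apply/funext => S; rewrite /Stot /S3 -mulr_sumr sumrB.
under eq_bigr do rewrite numopE.
under [X in _ * (_ - X)]eq_bigr do rewrite numopE.
rewrite -!mulr_suml !sum_mem nup_lift ndown_lift.
by rewrite /lift; case: ifP => _; field.
Qed.

Lemma Stot2_lift c : Stot2 (lift c psi) =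
  fun S => N%:R / 2 * (N%:R / 2 + 1) * lift c psi S.
Proof.
apply/funext => S; rewrite /Stot2 !S1_lift !S2_lift !S3_lift /lift.
case: ifP => _; last by rewrite mulr0 !addr0.
have ii : 'i%C * 'i%C = -1 :> C by rewrite -expr2 sqr_i.
have i0 : 'i%C != 0 :> C by apply: contra_eq_neq ii => ->; rewrite mul0r eq_sym oppr_eq0 oner_eq0.
(* Two applications of [S2] divide by the square of twice the imaginary unit, which is -4; this
   removes the imaginary unit before [field] is used. *)
have idiv (x y : C) : (x / (2 * 'i%C) - y / (2 * 'i%C)) / (2 * 'i%C) = (y - x) / 4.
  have -> : (x / (2 * 'i%C) - y / (2 * 'i%C)) / (2 * 'i%C) = (x - y) / (4 * ('i%C * 'i%C)).
    by field; rewrite i0.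
  by rewrite ii; field.
rewrite !(mulrA _ (_ - _)) !(mulrA _ (_ + _)) idiv.
(* The terms two steps away from [k] cancel between the squares of [S1] and [S2]. The cases 0 and 1
   are separate because the predecessor is taken twice. *)
case: (nup S) => [|[|k]] /=; rewrite -?natr1; field; by [].
Qed.

End TotalSpin.

(** * The space of finite-energy states *)

(** Invariance under transpositions of neighbours extends along paths to all transpositions. These
    carry any set to any other of the same size, by induction on the size of the difference. *)
Lemma swap_invariant (T : finType) (A : Type) (e : rel T) (F : {set T} -> A) :
  (forall x y, connect e x y) ->
  (forall x y (U : {set T}), e x y -> x \in U -> y \notin U ->
     F (y |: U :\ x) = F U) ->
  forall U V : {set T}, #|U| = #|V| -> F U = F V.
Proof.
move=> conn swap.
have memt x y z (U : {set T}) : (z \in tperm x y @: U) = (tperm x y z \in U).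
  by rewrite -{1}(tpermK x y z) mem_imset //; exact: perm_inj.
have tU x y (U : {set T}) : x \in U -> y \notin U -> tperm x y @: U = y |: U :\ x.
  move=> xU yU; apply/setP => z; rewrite memt !inE.
  case: tpermP => [->|->|/eqP zx /eqP zy]; rewrite ?eqxx ?orbT ?andbF ?orbF //=.
    by rewrite (negbTE yU); apply/esym; apply: contraNF yU => /eqP <-.
  by rewrite (negbTE zy) zx.
have tid x y (U : {set T}) : (x \in U) = (y \in U) -> tperm x y @: U = U.
  by move=> e'; apply/setP => z; rewrite memt; case: tpermP => [->|->|].
pose Q x y := forall U : {set T}, F (tperm x y @: U) = F U.
have Qe x y : e x y -> Q x y.
  move=> exy U; have [xU|xU] := boolP (x \in U); have [yU|yU] := boolP (y \in U).
  - by rewrite tid // xU yU.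
  - by rewrite tU // swap.
  - have e1 : tperm x y @: U = x |: U :\ y by rewrite tpermC tU.
    have ne : x != y by apply: contraNneq xU => ->.
    rewrite -(swap x y) ?e1 ?setU11 //; last by rewrite !inE eqxx eq_sym (negbTE ne).
    by rewrite setU1K ?setD1K // !inE negb_and xU orbT.
  - by rewrite tid // (negbTE xU) (negbTE yU).
have Qrefl x : Q x x by move=> U; rewrite tid.
have Qtrans x y z : Q x y -> Q y z -> Q x z.
  move=> Qxy Qyz; have [<-|xz] := eqVneq x z; first exact: Qrefl.
  have [<-//|yz] := eqVneq y z.
  (* The transposition of [x] and [z] is the conjugate of that of [y] and [z] by that of [x] and
     [y]. *)
  have E : tperm x z = (tperm x y * (tperm y z * tperm x y))%g.
    by rewrite -{1}(tpermV x y) -conjgE tpermJ tpermR tpermD.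
  have imM (s r : {perm T}) (U : {set T}) : (s * r)%g @: U = r @: (s @: U).
    by rewrite -imset_comp; apply: eq_imset => w; rewrite permM.
  by move=> U; rewrite E !imM Qxy Qyz Qxy.
have Qall x y : Q x y.
  have /connectP[p pth ->] := conn x y.
  elim: p x pth => [|w p IH] x //= /andP[xw pth].
  exact: Qtrans (Qe _ _ xw) (IH _ pth).
move=> U V; have [n] := ubnP #|U :\: V|; elim: n U => // n IH U ltn eUV.
have [/setP e0|[x]] := set_0Vmem (U :\: V).
  congr F; apply/eqP; rewrite eqEcard eUV leqnn andbT.
  by rewrite -setD_eq0; apply/eqP/setP.
rewrite inE => /andP[xV xU].
have : #|V :\: U| != 0%N.
  have := cardsID V U; have := cardsID U V; rewrite setIC eUV => <- /addnI <-.
  by rewrite (cardsD1 x) inE xV xU.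
rewrite cards_eq0 => /set0Pn[y]; rewrite inE => /andP[yU yV].
rewrite -(Qall x y); apply: IH; last by rewrite card_imset //; exact: perm_inj.
rewrite tU // -ltnS (leq_trans _ ltn) // ltnS.
rewrite [X in (_ < X)%N](cardsD1 x) inE xV xU add1n ltnS subset_leq_card //.
apply/subsetP => z; rewrite !inE => /andP[zV /orP[/eqP zy|/andP[-> ->]]]; last by rewrite zV.
by rewrite zy yV in zV.
Qed.

Lemma sum_delta (K : pzSemiRingType) (I : finType) (a : I) (F : I -> K) :
  \sum_i (i == a)%:R * F i = F a.
Proof.
rewrite (bigD1 a) //= eqxx mul1r big1 ?addr0 // => i /negbTE ->.
by rewrite mul0r.
Qed.

(** * Orthogonal one-particle orbitals and the filled orbital state *)

Section Orbitals.
Variables (R : realType) (M : finType) (B : {set M * M}) (zeta : nat) (mu : R).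
Local Notation C := R[i].
Local Notation a := (@acoef R M B zeta mu).
Local Notation b := (@bcoef R M B mu).
Implicit Types (x y : M) (z : site B) (v : bond B * bool) (psi : state C (site B)).

Lemma rc_real (r : R) : (r%:C)%C \is Num.real.
Proof. by rewrite complex_real. Qed.

Lemma acoef_conj x z : (a x z)^* = a x z.
Proof.
apply: conj_Creal; rewrite /acoef; case: z => [y|[e []]];
  by rewrite !(rpredM, rpredD, rpredN, rpredV, rc_real, realn).
Qed.

Lemma sum_site (F : site B -> C) : \sum_z F z =
  \sum_x F (inl x) + \sum_e (F (inr (e, true)) + F (inr (e, false))).
Proof.
rewrite big_sumType /=; congr (_ + _).
transitivity (\sum_(e : bond B) \sum_(s : bool) F (inr (e, s))).
  by rewrite pair_bigA; apply: eq_bigr => -[].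
by apply: eq_bigr => e _; rewrite big_bool.
Qed.

(** The orbitals overlap only on the two added sites of a bond joining [x] and [y], where the
    contributions are opposite: the two ends have equal signs at [u] and opposite signs at
    [ubar]. *)
Lemma acoef_orth x y : x != y -> \sum_z a x z * (a y z)^* = 0.
Proof.
move=> xy; rewrite sum_site !big1 ?addr0 // => [e _|w _]; rewrite !acoef_conj /acoef.
  case: (eqVneq (val e).1 x) => [->|_]; case: (eqVneq (val e).2 x) => [->|_];
    rewrite ?(negbTE xy) /=; ring.
by have [->|_] := eqVneq w x; rewrite ?(negbTE xy) !(mulr0, mul0r).
Qed.

Lemma acoef_norm_neq0 x : \sum_z a x z * (a x z)^* != 0.
Proof.
rewrite psumr_neq0 => [|z _]; last exact: mul_conjC_ge0.
apply/hasP; exists (inl x); rewrite ?mem_index_enum //=.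
rewrite mul_conjC_gt0 /acoef eqxx mulr1 eq_complex negb_and /= invr_eq0 eqxx orbF.
by rewrite sqrtr_eq0 -ltNge -natrM ltr_wpDr // mulr_ge0 ?ler0n ?sqr_ge0.
Qed.

Lemma sum_bcoef v (F : site B -> C) : \sum_z b v z * F z = F (inr v) +
  \sum_x b v (inl x) * F (inl x).
Proof.
by rewrite big_sumType /= addrC; congr (_ + _); rewrite sum_delta.
Qed.

(** Two sites contribute, [v] and [x]. If [x] is an end of the bond of [v], the coefficient of [b]
    at [x] is minus the unnormalized coefficient of [a] at [v]; otherwise both vanish. *)
Lemma bcoef_acoef_orth v x : \sum_z b v z * (a x z)^* = 0.
Proof.
rewrite sum_bcoef !acoef_conj; under eq_bigr do rewrite acoef_conj.
have E : \sum_y b v (inl y) * a x (inl y) = b v (inl x) * a x (inl x).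
  rewrite (bigD1 x) //= big1 ?addr0 // => y /negbTE yx.
  by rewrite /acoef yx !mulr0.
rewrite {}E /bcoef /acoef eqxx; case: v => e [] /=;
  rewrite ![x == _]eq_sym; ring.
Qed.

Lemma annW_creW_comm w w' psi : \sum_z w z * (w' z)^* = 0 ->
  annW w (creW w' psi) = fun S => - creW w' (annW w psi) S :> C.
Proof.
move=> o; apply/funext => S; apply/eqP; rewrite -addr_eq0 annW_creW o.
by rewrite mul0r.
Qed.

Definition slater (s : seq M) : state C (site B) :=
  foldr (fun x psi => creW (a x) psi) (@vac C (site B)) s.

Lemma slater_Nstate s : is_Nstate (size s) (slater s).
Proof.
elim: s => [S|x s IH]; last exact: is_Nstate_creW.
by rewrite cards_eq0 /slater /= /vac => /negbTE ->.
Qed.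

Lemma annW_slater0 w s : (forall x, x \in s -> \sum_z w z * (a x z)^* = 0) ->
  annW w (slater s) = fun=> 0.
Proof.
elim: s => [|x s IH] o; first exact: annW_vac.
rewrite /= annW_creW_comm ?o ?mem_head // IH; last first.
  by move=> y ys; rewrite o // in_cons ys orbT.
by rewrite creW0; apply/funext => S; rewrite oppr0.
Qed.

Lemma bcoef_slater v s : annW (b v) (slater s) = fun=> 0.
Proof. by apply: annW_slater0 => x _; exact: bcoef_acoef_orth. Qed.

(** Annihilating the orbital created last gives back the shorter product times the squared norm of
    that orbital, since it is orthogonal to the remaining ones. *)
Lemma slater_neq0 s : uniq s -> slater s <> fun=> 0.
Proof.
elim: s => [_ /(congr1 (fun f => f set0))|x s IH].
  by rewrite /= /vac eqxx => /eqP; rewrite oner_eq0.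
move=> /= /andP[xs us] e; apply: (IH us); apply/funext => S.
have := annW_creW (a x) (a x) (slater s) S; rewrite e annW_slater0; last first.
  by move=> y ys; apply: acoef_orth; apply: contraNneq xs => ->.
rewrite creW0 addr0 /annW big1; last by move=> z _; rewrite ann0 mulr0.
by move=> /esym/eqP; rewrite mulf_eq0 (negbTE (acoef_norm_neq0 x)) => /eqP.
Qed.

Definition Msites : {set site B} := [set inl x | x in M].

Lemma card_Msites : #|Msites| = #|M|.
Proof. by rewrite card_imset // => x y []. Qed.

Lemma bker_eq0 psi : (forall v, annW (b v) psi = fun=> 0) ->
  (forall S : {set site B}, S \subset Msites -> psi S = 0) -> psi = fun=> 0.
Proof.
move=> ker ini; apply/funext => S.
pose w z := if z is inr v then b v else fun=> 0.
apply: (annW_ker_eq0 (P := fun z => z \in Msites) (b := w)) => {S}.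
- by move=> [x|v]; rewrite ?imset_f //= eqxx.
- move=> [x|v]; first by rewrite imset_f.
  move=> [y|v'] _; first by rewrite imset_f.
  by move=> _ /=; case: (eqVneq v' v) => [->|//]; rewrite eqxx.
- by move=> [x|v]; rewrite ?imset_f // => _; exact: ker.
- by move=> S SM; apply: ini; apply/subsetP => z /SM.
Qed.

Definition orb := slater (enum M).

Lemma orb_Nstate : is_Nstate #|M| orb.
Proof. by rewrite cardE; exact: slater_Nstate. Qed.

(** By particle number, [Msites] is the only subset of itself on which [orb] can be nonzero; were it
    zero there too, [bker_eq0] would make [orb] vanish. *)
Lemma orb_Msites : orb Msites != 0.
Proof.
apply/eqP => e; apply: (slater_neq0 (enum_uniq M)); apply: bker_eq0.
  by move=> v; exact: bcoef_slater.
move=> S SM; have [eS|] := eqVneq #|S| #|M|; last exact: orb_Nstate.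
have /eqP -> // : S == Msites.
by rewrite eqEcard SM card_Msites eS leqnn.
Qed.

(* All orbitals of [orb] being filled, [a^dag_x orb] is annihilated by every
   [b_v] but has more particles than [M] has sites. *)
Lemma creW_orb x : creW (a x) orb = fun=> 0.
Proof.
apply: bker_eq0 => [v|S SM].
  rewrite annW_creW_comm ?bcoef_acoef_orth // bcoef_slater creW0.
  by apply/funext => S; rewrite oppr0.
apply: (is_Nstate_creW _ orb_Nstate); rewrite neq_ltn ltnS.
by rewrite -card_Msites subset_leq_card.
Qed.

(** Moving the first annihilator across gives a creation operator, which anticommutes with the
    second annihilator and then kills the filled state. *)
Lemma inner_annW_orb x y : x != y -> inner (annW (a x) orb) (annW (a y) orb) = 0.
Proof.
move=> xy; rewrite -inner_creW.
have -> : creW (a x) (annW (a y) orb) = fun=> 0.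
  have := annW_creW_comm orb (acoef_orth (x := y) (y := x) _).
  rewrite creW_orb eq_sym => /(_ xy) e; apply/funext => S.
  have := congr1 (fun f : state C (site B) => - f S) e; rewrite opprK => <-.
  by rewrite /annW big1 ?oppr0 // => z _; rewrite ann0 mulr0.
by rewrite /inner big1 // => S _; rewrite mulr0.
Qed.

End Orbitals.

Arguments Msites {M} B.
Arguments orb {R M} B zeta mu.
Arguments orb_Nstate {R M} B zeta mu.
Arguments orb_Msites {R M} B zeta mu.

Lemma card_take_enum (T : finType) k : (k <= #|T|)%N ->
  #|[set x in take k (enum T)]| = k.
Proof.
move=> kT; transitivity (size (take k (enum T))); last by rewrite size_takel // -cardE.
rewrite -(card_uniqP (take_uniq k (enum_uniq T))).
by apply: eq_card => x; rewrite inE.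
Qed.

(** * Finite-energy states are lifts of the filled orbital state *)

Section Uniqueness.
Variables (R : realType) (M : finType) (B : {set M * M}) (zeta : nat) (mu : R).
Local Notation C := R[i].
Local Notation Msites := (Msites B).
Local Notation orb := (orb B zeta mu).
Implicit Types (phi : state C (mode B)) (U : {set M}) (S : {set mode B}).

Lemma bkerL_eq0 phi : (forall v sigma, annL (bcoef mu v) sigma phi = fun=> 0) ->
  (forall S, sites S \subset Msites -> phi S = 0) -> phi = fun=> 0.
Proof.
move=> ker ini; apply/funext => S.
pose w (m : mode B) := if m.1 is inr v then spinw (bcoef mu v) m.2 else fun=> 0.
apply: (annW_ker_eq0 (P := fun m => m.1 \in Msites) (b := w)) => {S}.
- by move=> [[x|v] s]; rewrite /= ?imset_f // /w /spinw /= !eqxx mulr1.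
- move=> [[x|v] s]; first by rewrite /= imset_f.
  move=> [[y|v'] s'] _; first by rewrite /= imset_f.
  rewrite /w /spinw /= => _; case: (eqVneq s' s) => [->|]; rewrite ?mul0r //.
  by case: (eqVneq v' v) => [->|]; rewrite ?mulr0 ?eqxx.
- by move=> [[x|v] s]; rewrite /= ?imset_f // => _; rewrite /w -annLE ker.
- move=> S SM; apply: ini; apply/subsetP => z /sitesP[s /SM]; exact.
Qed.

Definition conf U : {set mode B} := [set (inl x, x \in U) | x in M].

Lemma in_conf z s U : ((z, s) \in conf U) =
  if z is inl x then s == (x \in U) else false.
Proof.
apply/imsetP/idP => [[x _ [-> ->]]|]; first by rewrite eqxx.
by case: z => // x /eqP ->; exists x.
Qed.

Lemma nodbl_conf U : nodbl (conf U).
Proof. by apply/nodblP => -[x|v] s; rewrite !in_conf // => /eqP ->; case: (_ \in U). Qed.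

Lemma sites_conf U : sites (conf U) = Msites.
Proof.
apply/setP => -[x|v]; rewrite sitesE !in_conf; first by rewrite imset_f //; case: (x \in U).
by apply/esym/imsetP => -[].
Qed.

Lemma nup_conf U : nup (conf U) = #|U|.
Proof.
rewrite /nup -(card_imset (mem U) (f := @inl M (bond B * bool))); last by move=> ? ? [].
apply: eq_card => -[x|v]; rewrite inE in_conf; last by apply/esym/imsetP => -[].
by rewrite (mem_imset (mem U)); last by move=> ? ? [].
Qed.

Lemma lift_conf c U : lift c orb (conf U) = c #|U| * orb Msites.
Proof. by rewrite /lift nodbl_conf sites_conf nup_conf. Qed.

Lemma conf_of_sites S : sites S = Msites -> nodbl S ->
  S = conf [set x | (inl x, true) \in S].
Proof.
move=> sS /nodblP nd; apply/setP => -[z s]; rewrite in_conf.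
case: z => [x|v]; last first.
  apply/negP => vS; have : inr v \in sites S by apply/sitesP; exists s.
  by rewrite sS => /imsetP[].
have : inl x \in sites S by rewrite sS imset_f.
rewrite inE sitesE; have := nd (inl x) true; have := nd (inl x) false.
by case: s => /=; case: (_ \in S); case: (_ \in S) => // /(_ isT).
Qed.

Lemma annL_bcoef (e : bond B) sigma phi S :
  annL (bcoef mu (e, false)) sigma phi S = ann (inr (e, false), sigma) phi S -
  (mu%:C)%C * (ann (inl (val e).1, sigma) phi S + ann (inl (val e).2, sigma) phi S).
Proof.
rewrite /annL sum_bcoef; congr (_ + _) => /=.
under eq_bigr do rewrite mulNr -mulrA mulrDl.
rewrite sumrN -mulr_sumr big_split /=.
by rewrite !(sum_delta _ (fun x => ann (inl x, sigma) phi S)).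
Qed.

Lemma ann_scaleD (T : finType) (m : T) (a : C) (f g : state C T) X :
  ann m (fun X => a * (f X + g X)) X = a * (ann m f X + ann m g X).
Proof. by rewrite /ann; case: ifP => _; ring. Qed.

Hypothesis mu0 : 0 < mu.

Section Constrained.
Variable phi : state C (mode B).
Hypothesis phiC : constrained mu phi.

Lemma ann_double z s S : ann (z, s) (ann (z, ~~ s) phi) S = 0.
Proof.
rewrite /ann; case: ifP => // zS; case: ifP => [|zS']; rewrite ?mulr0 //.
rewrite phiC.2 ?mulr0 //; apply/negP => /nodblP/(_ z s).
by rewrite !inE !eqxx /= orbT => /(_ isT).
Qed.

(** Annihilating both spins at [u(x,y)] gives zero. Replacing each annihilator at [u] by [mu] times
    the sum of those at [x] and [y], the terms with both spins at one site vanish too, and the cross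
    terms give the exchange relation. *)
Lemma ann_exchange_bond x y S : (x, y) \in B ->
  ann (inl x, false) (ann (inl y, true) phi) S =
  ann (inl x, true) (ann (inl y, false) phi) S.
Proof.
move=> xyB; pose e : bond B := exist _ (x, y) xyB.
have muC : (mu%:C)%C != 0 :> C by rewrite eq_complex negb_and /= gt_eqF.
have bE s : ann (inr (e, false), s) phi =
    fun S => (mu%:C)%C * (ann (inl x, s) phi S + ann (inl y, s) phi S).
  apply/funext => S'; apply/eqP; rewrite -subr_eq0; apply/eqP.
  by rewrite -(annL_bcoef e) phiC.1.
have := ann_double (inr (e, false)) true S; rewrite /= bE ann_scaleD.
(* The remaining annihilator at [u] must act directly on [phi] before it can be replaced. *)
rewrite ![ann (inr _, _) _ _]ann_ann bE !ann_scaleD.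
rewrite (ann_double (inl x) false) (ann_double (inl y) false) add0r addr0.
rewrite -opprD -mulrDr mulrN => /eqP; rewrite oppr_eq0 !mulf_eq0 (negbTE muC) /=.
by rewrite [X in _ + X]ann_ann subr_eq0 => /eqP.
Qed.

Lemma ann_exchange x y S : Erel B x y ->
  ann (inl x, false) (ann (inl y, true) phi) S =
  ann (inl x, true) (ann (inl y, false) phi) S.
Proof.
case/orP=> [|/ann_exchange_bond h]; first exact: ann_exchange_bond.
by rewrite ann_ann -h -ann_ann.
Qed.

(** The exchange relation is evaluated at [conf U] with [x] and [y] emptied. The signs depend on the
    sites alone, so they agree on both sides and cancel. *)
Lemma conf_exchange x y U : Erel B x y -> x \in U -> y \notin U ->
  phi (conf (y |: U :\ x)) = phi (conf U).
Proof.
move=> exy xU yU; have xy : x != y by apply: contraNneq yU => <-.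
pose S := [set m in conf U | (m.1 != inl x) && (m.1 != inl y)].
have inS z s : ((z, s) \in S) = [&& (z, s) \in conf U, z != inl x & z != inl y].
  by rewrite inE.
have ndS : nodbl S.
  apply/nodblP => z s; rewrite !inS => /andP[/(nodblP _ (nodbl_conf U)) zU _].
  by rewrite (negbTE zU).
have xS : inl x \notin sites S by rewrite sitesE !inS eqxx /= !andbF.
have yS : inl y \notin sites S by rewrite sitesE !inS eqxx /= !andbF.
have nS z s : z \notin sites S -> (z, s) \notin S.
  by apply: contra => zS; apply/sitesP; exists s.
have ann2 s s' : ann (inl x, s) (ann (inl y, s') phi) S =
    fsign C (inl x) (sites S) * (fsign C (inl y) (inl x |: sites S) *
    phi ((inl y, s') |: ((inl x, s) |: S))).
  rewrite /ann (negbTE (nS _ s xS)) in_setU1 (negbTE (nS _ s' yS)).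
  rewrite xpair_eqE (inj_eq inl_inj) eq_sym (negbTE xy) /=.
  rewrite (fsign_sites _ _ ndS xS) fsign_sites ?sitesU //.
    by rewrite nodblU ?nS // ndS.
  by rewrite !inE negb_or yS (inj_eq inl_inj) eq_sym xy.
have := ann_exchange S exy; rewrite !ann2.
move=> /(mulfI (fsign_neq0 _ _ _))/(mulfI (fsign_neq0 _ _ _)).
have E U' : {in predC (pred2 x y), U =i U'} ->
    ((inl y, y \in U') |: ((inl x, x \in U') |: S)) = conf U'.
  move=> eU; apply/setP => -[z s]; rewrite !in_setU1 inS !in_conf !xpair_eqE.
  case: z => [z|v] //=; rewrite !(inj_eq inl_inj).
  have [->|zy] := eqVneq z y; first by rewrite (eq_sym y) (negbTE xy) ?eqxx /= ?andbF ?orbF.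
  have [->|zx] := eqVneq z x; first by rewrite ?eqxx /= ?andbF ?orbF.
  by rewrite /= andbT eU // !inE negb_or zx zy.
rewrite -(E U) // -(E (y |: U :\ x)); last first.
  by move=> z; rewrite !inE negb_or => /andP[/negbTE-> /negbTE->].
by rewrite xU (negbTE yU) !inE eqxx /= eqxx (negbTE xy).
Qed.

Lemma constrained_lift : (forall x y : M, connect (Erel B) x y) ->
  is_Nstate #|M| phi -> exists c, phi = lift c orb.
Proof.
move=> conn phiN.
(* [seg k] represents all up sets of size [k]. Dividing by [orb Msites] makes the lift agree with
   [phi] on [conf (seg k)]. *)
pose seg k := [set x in take k (enum M)].
pose c k := phi (conf (seg k)) / orb Msites.
exists c; suff : (fun S => phi S - lift c orb S) = fun=> 0.
  by move=> e; apply/funext => S; apply/eqP; rewrite -subr_eq0; apply/eqP/(congr1 (@^~ S) e).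
apply: bkerL_eq0 => [v s|S SM].
  apply/funext => S.
  transitivity (annL (bcoef mu v) s phi S - annL (bcoef mu v) s (lift c orb) S).
    rewrite /annL -sumrB; apply: eq_bigr => z _.
    by rewrite /ann; case: ifP => _; ring.
  by rewrite phiC.1 annL_lift bcoef_slater /lift mulr0 if_same subr0.
have [nd|nd] := boolP (nodbl S); last by rewrite phiC.2 // /lift (negbTE nd) subr0.
have [eS|neS] := eqVneq #|S| #|M|; last first.
  by rewrite phiN // (is_Nstate_lift c (orb_Nstate B zeta mu)) // subr0.
(* As many singly occupied sites as [M] has, all inside [Msites], must fill it. *)
have sS : sites S = Msites.
  by apply/eqP; rewrite eqEcard SM card_Msites card_sites // eS leqnn.
rewrite (conf_of_sites sS nd) lift_conf; set U := [set x | _].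
rewrite /c divfK ?orb_Msites //.
rewrite (swap_invariant (F := fun U => phi (conf U)) conn _ (V := seg #|U|)) ?subrr //.
  by move=> x y V; exact: conf_exchange.
by rewrite card_take_enum // max_card.
Qed.

End Constrained.

Lemma lift_constrained c : constrained mu (lift c orb).
Proof.
split=> [v s|S /negbTE nd]; last by rewrite /lift nd.
by rewrite annL_lift bcoef_slater; apply/funext => S; rewrite /lift mulr0 if_same.
Qed.

(** The spin factor splits off each hopping term, leaving the overlap of [inner_annW_orb]. *)
Lemma hop_lift c : (forall x y, (x, y) \in B -> x != y) ->
  hop zeta mu (lift c orb) = 0.
Proof.
move=> irr; apply: big1 => x _; apply: big1 => y exy; apply: big1 => s _.
have xy : x != y by case/orP: exy => /irr //; rewrite eq_sym.
rewrite !annL_lift.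
have [kappa ->] := inner_lift (site B) #|M|.-1 (fun k => c (s + k)%N) (fun k => c (s + k)%N).
  by rewrite inner_annW_orb // mulr0.
exact/is_Nstate_annW/orb_Nstate.
Qed.

End Uniqueness.

Arguments conf {M} B U.

(** * The ground states and their spin multiplet *)

Theorem theorem1 (R : realType) (M : finType) (B : {set M * M})
    (zeta : nat) (mu t : R) :
  (forall x y : M, (x, y) \in B -> x != y) ->
  (forall x y : M, (x, y) \in B -> (y, x) \notin B) ->
  (forall x y : M, connect (Erel B) x y) ->
  (forall x : M, #|[pred y | Erel B x y]| = zeta) ->
  0 < mu -> 0 < t ->
  let Ne := #|M| in
  let Smax : R[i] := Ne%:R / 2 in
  (* every ground state has total spin S_tot = S_max *)
  (forall phi : state R[i] (mode B),
      ground_state zeta mu t Ne phi ->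
      Stot2 phi = (fun S => Smax * (Smax + 1) * phi S)) /\
  (* uniqueness up to the (2 S_max + 1)-fold spin degeneracy: the ground
     states are exactly the normalized vectors of a subspace of dimension
     2 S_max + 1 = Ne + 1 *)
  (exists f : 'I_Ne.+1 -> state R[i] (mode B),
      (forall c : 'I_Ne.+1 -> R[i],
          (forall S, \sum_i c i * f i S = 0) -> forall i, c i = 0) /\
      (forall phi : state R[i] (mode B),
          ground_state zeta mu t Ne phi <->
          (normalized phi /\
           exists c : 'I_Ne.+1 -> R[i], forall S, phi S = \sum_i c i * f i S))).
Proof.
move=> irr _ conn _ mu0 _ Ne Smax.
pose psi := orb B zeta mu.
have psiN : is_Nstate Ne psi := orb_Nstate B zeta mu.
have lift0 c : lim_energy zeta mu t (lift c psi) = 0%E.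
  by rewrite lim_energyE ?hop_lift ?mulr0 //; exact: lift_constrained.
have ground phi : ground_state zeta mu t Ne phi <->
    normalized phi /\ exists c, phi = lift c psi.
  split=> [[phiN phi1 phimin]|[phi1 [c e]]]; last first.
    split; [by rewrite e; exact: is_Nstate_lift | exact: phi1 |].
    move=> chi chiN _; rewrite e lift0.
    have [chiC|/lim_energy_oo ->] := pselect (constrained mu chi); last by rewrite leey.
    by have [c' ->] := constrained_lift zeta mu0 chiC conn chiN; rewrite lift0.
  split; first exact: phi1.
  apply: (constrained_lift zeta mu0 _ conn phiN); apply: contrapT => nC.
  (* An unconstrained state has infinite energy; this lift, once normalized, is a competitor of
     energy zero. *)
  pose chi := lift (fun=> 1) psi.
  have chi0 : inner chi chi != 0.
    apply/eqP => /inner_eq0/(congr1 (fun g => g (conf B set0))) /eqP.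
    by rewrite /chi /psi lift_conf mul1r (negbTE (orb_Msites B zeta mu)).
  pose r := (sqrtC (inner chi chi))^-1.
  have chi1 : normalized (lift (fun=> r) psi).
    have -> : lift (fun=> r) psi = fun S => r * chi S.
      by apply/funext => S; rewrite /chi /lift; case: ifP; rewrite ?mulr0 ?mul1r.
    rewrite /normalized innerZr -inner_conj innerZr rmorphM /= inner_conj.
    have -> : r^* = r by rewrite conj_Creal // rpredV realE sqrtC_ge0 inner_ge0.
    by rewrite mulrA -expr2 exprVn sqrtCK mulVf.
  have := phimin _ (is_Nstate_lift _ psiN) chi1.
  by rewrite lift0 lim_energy_oo.
split=> [phi /ground[_ [c ->]]|]; first exact: Stot2_lift.
(* The basis vector [f i] is the part of the multiplet with exactly [i] up spins. *)
pose f (i : 'I_Ne.+1) := lift (fun k : nat => (k == i)%:R) psi.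
have fE (c : 'I_Ne.+1 -> R[i]) S :
    \sum_i c i * f i S = lift (fun k : nat => \sum_i c i * (k == i)%:R) psi S.
  exact: lift_sum.
have sumE (c : 'I_Ne.+1 -> R[i]) (k : 'I_Ne.+1) : \sum_i c i * (k == i :> nat)%:R = c k.
  under eq_bigr do rewrite mulrC eq_sym (inj_eq (@ord_inj _)).
  exact: sum_delta.
exists f; split=> [c c0 i|phi].
  have card_seg : #|[set x in take i (enum M)]| = i.
    by rewrite card_take_enum // -ltnS.
  (* A configuration with [i] up spins isolates the coefficient [c i]. *)
  have /eqP := c0 (conf B [set x in take i (enum M)]).
  rewrite fE /psi lift_conf card_seg sumE mulf_eq0 (negbTE (orb_Msites B zeta mu)) orbF.
  by move/eqP.
rewrite ground; split=> -[phi1 [c e]]; (split; first exact: phi1).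
  (* Only the weights at [k] up to [Ne] matter, so a function on all naturals may be restricted. *)
  exists (fun i => c i) => S; rewrite fE e; congr (_ S); apply: eq_lift psiN _ => k kN.
  by rewrite (sumE (fun i => c i) (Ordinal (kN : (k < Ne.+1)%N))).
by exists (fun k : nat => \sum_i c i * (k == i)%:R); apply/funext => S; rewrite e fE.
Qed.
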